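(* Let $\mathcal H$ be a reproducing kernel Hilbert space of functions on a region $\mathcal E\subset\mathbb C$ satisfying the standing assumptions listed in the context (including the boundary vanishing condition). Let $a_1,\dots,a_{n-1}\in\mathcal E$ be previously given (repetitions allowed), let $\{B_1,\dots,B_{n-1}\}$ be the Gram–Schmidt orthonormalization of $\{\tilde k_{a_1},\dots,\tilde k_{a_{n-1}}\}$, and let $f\in\mathcal H$. Let $\{b_j\}_{j=1}^\infty$ be a sequence in $\mathcal E$, as provided by the Maximal Selection Principle, such that none of the $b_j$ takes any of the values $a_1,\dots,a_{n-1}$, $\lim_{j\to\infty}b_j=a_n\in\mathcal E$, and $$\lim_{j\to\infty}|\langle f,B_n^{b_j}\rangle|=\max\{|\langle f,B_n^a\rangle|\ :\ a\in\mathcal E\}.$$ Then $$\lim_{j\to\infty}B_n^{b_j}=B_n^{a_n},$$ where $\{B_1,\dots,B_{n-1},B_n^{a_n}\}$ is the Gram–Schmidt orthonormalization of $\{\tilde k_{a_1},\dots,\tilde k_{a_{n-1}},\tilde k_{a_n}\}$.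
   Context: Standing assumptions. $\mathcal E\subset\mathbb C$ is an open connected region (possibly unbounded). $\mathcal H$ is a Hilbert space consisting of functions defined in $\mathcal E$, with reproducing kernel $k_a$, $a\in\mathcal E$, so $f(a)=\langle f,k_a\rangle$. The kernel $k_a$ is a real-analytic function of the variable $\overline a$ in $\mathcal E$ and satisfies $f^{(l)}(a)=\langle f,(\partial/\partial\overline a)^l k_a\rangle$ for $l=1,2,\dots$. Multiplicities. For a finite or infinite sequence $a_1,a_2,\dots$ in $\mathcal E$, $l(a_n)$ denotes the number of times the value $a_n$ occurs in the $n$-tuple $(a_1,\dots,a_n)$, and $$\tilde k_{a_n}=\Big[\Big(\frac{\partial}{\partial\overline a}\Big)^{l(a_n)-1}k_a\Big]_{a=a_n}.$$ Given $a_1,\dots,a_{n-1}$ and the Gram–Schmidt orthonormalization $\{B_1,\dots,B_{n-1}\}$ of $\{\tilde k_{a_1},\dots,\tilde k_{a_{n-1}}\}$, for $a\in\mathcal E$ with $a\ne a_k$, $k=1,\dots,n-1$, the function $B_n^a$ is such that $\{B_1,\dots,B_{n-1},B_n^a\}$ is the Gram–Schmidt orthonormalization of $\{\tilde k_{a_1},\dots,\tilde k_{a_{n-1}},k_a\}$, i.e. $$B_n^a=\frac{k_a-\sum_{k=1}^{n-1}\langle k_a,B_k\rangle B_k}{\|k_a-\sum_{k=1}^{n-1}\langle k_a,B_k\rangle B_k\|}.$$ If $a$ coincides with one of $a_1,\dots,a_{n-1}$, then $B_n^a$ is defined in the same way with $k_a$ replaced by $\tilde k_a$, where the multiplicity of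 $a$ is counted in the $n$-tuple $(a_1,\dots,a_{n-1},a)$. Boundary vanishing condition: for all previously given $a_1,\dots,a_{n-1}$ and every $f\in\mathcal H$, $\lim_{a\to\partial\mathcal E}\langle f,B_n^a\rangle=0$, where the limit is in the sense of the topology of the one-point compactification $\mathbb C\cup\{\infty\}$ of the complex plane. The Maximal Selection Principle is the consequence (by a Bolzano–Weierstrass compactness argument) that a sequence $\{b_j\}$ with the properties in the claim exists.
   Formalization: If a_n occurs m ≥ 1 times among a_1,…,a_{n-1}, the literal limit fails (Hardy space, a_1=0, f=z, b_j=(-1/2)^j); the limit proved is that of ((b_j-a_n)/|b_j-a_n|)^m B_n^{b_j}. The vectors k̃_{a_1},…,k̃_{a_n} are assumed linearly independent. *)

(* Defs.v *)
From HB Require Import structures.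
From mathcomp Require Import all_boot all_order all_algebra.
From mathcomp Require Export complex sesquilinear.
From mathcomp Require Import all_classical all_reals all_analysis.
Set Implicit Arguments.
Unset Strict Implicit.
Unset Printing Implicit Defensive.
Import Order.TTheory GRing.Theory Num.Theory numFieldNormedType.Exports.
Local Open Scope ring_scope.
Local Open Scope classical_set_scope.

(* [R[i]] itself carries no topology in the library; [R[i]^o] does. *)
Notation cplx R := (R[i]^o).

Section Wirtinger.
Context {R : realType} {V : normedModType R[i]}.
Implicit Types F : cplx R -> V.

(* Partial derivatives of F (x + i y) in the real variables x and y. *)
Definition partialx F (a : cplx R) : V :=
  lim ((h%:C%C)^-1 *: (F (a + h%:C%C) - F a) @[h --> (0 : R)^']).

Definition partialy F (a : cplx R) : V :=
  lim ((h%:C%C)^-1 *: (F (a + 'i * h%:C%C) - F a) @[h --> (0 : R)^']).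

(* d / d(conj a) *)
Definition dbar F (a : cplx R) : V :=
  2^-1 *: (partialx F a + 'i *: partialy F a).

End Wirtinger.

Section RKHS.
Context {R : realType}.

(* A Hilbert space of functions on E: elements of the complete normed space H
   are read as functions on E through [eval], faithfully by [eval_inj]; the
   values of [eval f] and [kernel] outside E are irrelevant.  Linearity of
   [eval] on E follows from [reproducing].  The inner product is linear in its
   first argument and conjugate-linear in the second. *)
Record rkhs (E : set (cplx R)) (H : completeNormedModType R[i]) := Rkhs {
  ip : {dot H for Num.conj} ;
  ip_norm : forall f, ip f f = `|f| ^+ 2 ;
  eval : H -> cplx R -> cplx R ;
  eval_inj : forall f g, (forall a, E a -> eval f a = eval g a) -> f = g ;
  kernel : cplx R -> H ;
  reproducing : forall f a, E a -> eval f a = ip f (kernel a) ;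
  (* norm-convergent power series in conj a around each point of E *)
  kernel_analytic : forall a0, E a0 -> exists c : nat -> H,
    \forall a \near a0,
      series (fun l => (Num.conj (a - a0)) ^+ l *: c l) @ \oo --> kernel a ;
  (* f^(l) is the complex derivative: the variable ranges over R[i] *)
  reproducing_derive : forall f (l : nat) a, (0 < l)%N -> E a ->
    (eval f)^`(l) a = ip f (iter l dbar kernel a) }.

Context {E : set (cplx R)} {H : completeNormedModType R[i]} (K : rkhs E H).
Implicit Types (s : seq (cplx R)) (vs bs : seq H) (a : cplx R) (v w : H).

(* [mult s a] is l(a) for the tuple (s, a). *)
Definition mult s a : nat := count_mem a (rcons s a).

Definition ktilde s a : H := iter (mult s a).-1 dbar (kernel K) a.

Definition ktildes s : seq H :=
  [seq ktilde (take i s) (nth 0 s i) | i <- iota 0 (size s)].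

Definition gs_next bs v : H :=
  let w := v - \sum_(b <- bs) ip K v b *: b in `|w|^-1 *: w.

Definition gram_schmidt vs : seq H :=
  foldl (fun bs v => rcons bs (gs_next bs v)) [::] vs.

(* The function B_n^a, where s = (a_1, ..., a_(n-1)). *)
Definition Bnext s a : H := gs_next (gram_schmidt (ktildes s)) (ktilde s a).

Definition lin_indep vs : Prop :=
  forall c : nat -> R[i], \sum_(0 <= i < size vs) c i *: nth 0 vs i = 0 ->
    forall i, (i < size vs)%N -> c i = 0.

Lemma ktilde_notin s a : a \notin s -> ktilde s a = kernel K a.
Proof.
by move=> /count_memPn s0; rewrite /ktilde /mult -cats1 count_cat s0 /= eqxx.
Qed.

Lemma ktildes_rcons s a : ktildes (rcons s a) = rcons (ktildes s) (ktilde s a).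
Proof.
rewrite /ktildes size_rcons -addn1 iotaD map_cat cats1; congr rcons.
  apply/eq_in_map => i; rewrite mem_iota add0n => /andP[_ si].
  by rewrite -cats1 takel_cat ?nth_cat ?si// ltnW.
by rewrite add0n -cats1 takel_cat// take_size nth_cat ltnn subnn.
Qed.

Lemma gram_schmidt_rcons s a :
  gram_schmidt (ktildes (rcons s a)) =
  rcons (gram_schmidt (ktildes s)) (Bnext s a).
Proof. by rewrite ktildes_rcons /gram_schmidt foldl_rcons. Qed.

(* Boundary of E in the Riemann sphere; [None] is the point at infinity. *)
Definition sphere_boundary (A : set (cplx R)) :
    set (one_point_compactification (cplx R)) :=
  let A' : set (one_point_compactification (cplx R)) := Some @` A in
  closure A' `\` interior A'.

(* <f, B_n^a> tends to 0 as a in E tends to the boundary of E; the value of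
   [oapp] at infinity is irrelevant, infinity being no point of [Some @` E]. *)
Definition boundary_vanishing : Prop :=
  forall s, (forall a, a \in s -> E a) -> forall f,
    (oapp (fun a => ip K f (Bnext s a)) 0 p : cplx R)
      @[p --> within (Some @` E) (set_nbhs (sphere_boundary E))] --> (0 : cplx R).

End RKHS.

(* Main.v *)
(* Near [an] the kernel is a power series in [conj (a - an)] whose coefficient
   of index l is, up to l!, the l-th dbar derivative of the kernel at [an]
   (termwise differentiation).  Let m be the multiplicity of [an] in [s].  The
   Gram-Schmidt residual P kills the coefficients of index l < m, which are
   multiples of vectors of [ktildes K s], but not the m-th one, c_m, by linear
   independence.  Hence P k_a = conj (a - an)^m (P c_m + O(|a - an|)), and
   normalising gives B_n^(b_j) = (conj z_j / |z_j|)^m (B_n^an + o(1)) with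
   z_j = b_j - an. *)
Require Import Defs.
From HB Require Import structures.
From mathcomp Require Import all_boot all_order all_algebra.
From mathcomp Require Import all_classical all_reals all_analysis.
From mathcomp Require Import ring.
Import Order.TTheory GRing.Theory Num.Theory numFieldNormedType.Exports.
Local Open Scope ring_scope.
Local Open Scope classical_set_scope.

(** * Series with geometrically dominated terms *)

Section DominatedSeries.
Context {R : realType}.
Implicit Type V : normedModType R[i].

(** The order on [R[i]] is partial, but a positive [e] is real, so the Archimedean property of [R]
    and n < 2^n apply. *)
Lemma expr_half_small (e : R[i]) : 0 < e ->
  exists N, forall n, (N <= n)%N -> 2^-1 ^+ n < e.
Proof.
move=> e0; have := gtr0_real e0 => /complex_realP[x ex].
have x0 : 0 < x by rewrite -ltcR -ex.
exists (Num.bound x^-1) => n Nn.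
have xn : x^-1 < 2 ^+ n.
  have /archi_boundP/lt_le_trans : 0 <= x^-1 by rewrite invr_ge0 ltW.
  by apply; rewrite -natrX ler_nat (leq_trans Nn)// ltnW// ltn_expl.
rewrite exprVn invf_plt ?posrE ?exprn_gt0// ex -fmorphV.
have -> : 2 ^+ n = (2 ^+ n : R)%:C%C by rewrite rmorphXn rmorph_nat.
by rewrite ltcR.
Qed.

Lemma sum_expr_half_le (m n : nat) :
  \sum_(m <= k < n) (2^-1 : R[i]) ^+ k <= 2 * 2^-1 ^+ m.
Proof.
have [mn|nm] := leqP m n; last first.
  by rewrite big_geq ?mulr_ge0 ?exprn_ge0 ?invr_ge0// ltnW.
suff -> : \sum_(m <= k < n) (2^-1 : R[i]) ^+ k = 2 * 2^-1 ^+ m - 2 * 2^-1 ^+ n.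
  by rewrite gerBl mulr_ge0 ?exprn_ge0 ?invr_ge0.
elim: n mn => [|n IH]; first by rewrite leqn0 => /eqP->; rewrite big_geq ?subrr.
rewrite leq_eqVlt ltnS => /predU1P[->|mn]; first by rewrite big_geq ?subrr.
by rewrite big_nat_recr//= IH// exprS; field.
Qed.

Lemma norm_cvg_le V (u : nat -> V) (l : V) (B : R[i]) :
  u @ \oo --> l -> (\forall n \near \oo, `|u n| <= B) -> `|l| <= B.
Proof.
move=> /cvgrPdist_lt ul uB; apply/ler_addgt0Pr => e e0.
have [n [un]] := filter_ex (filterI uB (ul e e0)).
move=> /ltW lun; rewrite -[l](subrKC (u n)) (le_trans (ler_normD _ _))//.
by rewrite lerD.
Qed.

Lemma sum_dominated_le V (u : nat -> V) (M : R[i]) (m n : nat) :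
  (forall k, `|u k| <= M * 2^-1 ^+ k) ->
  `|\sum_(m <= k < n) u k| <= 2 * M * 2^-1 ^+ m.
Proof.
move=> uM; rewrite (le_trans (ler_norm_sum _ _ _))//.
apply: (@le_trans _ _ (\sum_(m <= k < n) M * 2^-1 ^+ k)); first exact: ler_sum.
rewrite -mulr_sumr (mulrC 2) -mulrA ler_wpM2l ?sum_expr_half_le//.
by have := uM 0%N; rewrite expr0 mulr1; exact: le_trans.
Qed.

Lemma dominated_series_cvg (V : completeNormedModType R[i]) (u : nat -> V)
    (M : R[i]) :
  (forall k, `|u k| <= M * 2^-1 ^+ k) -> cvgn (series u).
Proof.
move=> uM; apply/cauchy_cvgP/cauchy_seriesP => e e0.
have M0 : 0 <= M by have := uM 0%N; rewrite expr0 mulr1; exact: le_trans.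
(* The added 1 keeps the denominator positive when [M] is 0. *)
have e0' : 0 < e / (2 * M + 1) by rewrite divr_gt0// ltr_wpDl// mulr_ge0.
have [N NP] := expr_half_small _ e0'.
exists ([set n | (N <= n)%N], [set n | (N <= n)%N]) => /=.
  by split; exists N.
move=> -[m n] [/= Nm _]; apply: (le_lt_trans (sum_dominated_le _ _ _ m n uM)).
have := NP _ Nm; rewrite ltr_pdivlMr ?ltr_wpDl ?mulr_ge0// => h.
rewrite (le_lt_trans _ h)// mulrC ler_wpM2l ?exprn_ge0 ?invr_ge0//.
by rewrite lerDl.
Qed.

Lemma dominated_series_le V (u : nat -> V) (l : V) (M : R[i]) :
  (forall k, `|u k| <= M * 2^-1 ^+ k) -> series u @ \oo --> l ->
  `|l| <= 2 * M.
Proof.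
move=> uM /norm_cvg_le; apply; near=> n.
by have := sum_dominated_le _ _ _ 0 n uM; rewrite expr0 mulr1.
Unshelve. all: by end_near. Qed.

End DominatedSeries.

(** * Power series in the conjugate variable *)

(** The property asked of the kernel in [kernel_analytic], stated for any function so that it can be
    passed on to [dbar F] and to Gram-Schmidt residuals of [F]. *)
Definition conj_pseries {R : realType} {V : normedModType R[i]}
    (F : cplx R -> V) (c : nat -> V) (a0 : cplx R) : Prop :=
  \forall a \near a0,
    series (fun l => (Num.conj (a - a0)) ^+ l *: c l) @ \oo --> F a.

Section ConjPowerSeries.
Context {R : realType}.
Implicit Type V : normedModType R[i].

(** Cauchy estimate: the series converges at [a0 + e / 2], where conjugation leaves the increment
    fixed, so its terms tend to 0 and are bounded; [r] is [e / 2]. *)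
Lemma conj_pseries_bound V (F : cplx R -> V) (c : nat -> V) (a0 : cplx R) :
  conj_pseries F c a0 -> exists r M : R[i],
    [/\ 0 < r, 0 <= M, forall k, `|c k| * r ^+ k <= M &
      forall a, `|a - a0| < r ->
        series (fun l => (Num.conj (a - a0)) ^+ l *: c l) @ \oo --> F a].
Proof.
move=> /nbhs_normP[e /= e0 eF].
have e20 : 0 < e / 2 by rewrite divr_gt0.
have e2 : Num.conj (e / 2) = e / 2 by apply/CrealP/gtr0_real.
have Fe : series (fun l => (e / 2) ^+ l *: c l) @ \oo --> F (a0 + e / 2).
  have := eF (a0 + e / 2); rewrite addrAC subrr add0r e2; apply.
  rewrite /ball_/= opprD addNKr normrN gtr0_norm//.
  by rewrite ltr_pdivrMr// ltr_pMr ?ltr1n.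
have [B [Br BP]] := cvg_seq_bounded (cvgP _ (cvg_series_cvg_0 (cvgP _ Fe))).
have BB : B < `|B| + 1.
  by rewrite (le_lt_trans (real_ler_norm Br))// ltrDl.
exists (e / 2), (`|B| + 1); split => //.
- move=> k; have := BP _ BB k I; rewrite /= normrZ normrX gtr0_norm//.
  by rewrite mulrC.
- move=> a aa0; apply: eF; rewrite /ball_/= distrC (lt_trans aa0)//.
  by rewrite ltr_pdivrMr// ltr_pMr ?ltr1n.
Qed.

(** With E_k the remainder, E_(k+1) = y E_k + k x^(k-1) (y - x)^2, and k^2 + k <= (k+1)^2 closes the
    induction. The factor s^2 on the left avoids the exponent k - 2 on the right. *)
Lemma pow_taylor1_le (x y s : R[i]) (k : nat) : `|x| <= s -> `|y| <= s ->
  s ^+ 2 * `|y ^+ k - x ^+ k - k%:R * x ^+ k.-1 * (y - x)| <=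
    k%:R ^+ 2 * s ^+ k * `|y - x| ^+ 2.
Proof.
move=> xs ys; have s0 := le_trans (normr_ge0 _) xs.
elim: k => [|k IH]; first by rewrite !(mul0r, subrr, normr0, mulr0, expr0n).
set E := y ^+ k - _ - _ in IH.
have -> : y ^+ k.+1 - x ^+ k.+1 - k.+1%:R * x ^+ k.+1.-1 * (y - x) =
    y * E + k%:R * x ^+ k.-1 * (y - x) ^+ 2.
  rewrite /E -natr1 /=; case: k {IH E} => [|k]; first by rewrite /=; ring.
  by rewrite /= !exprS; ring.
apply: (@le_trans _ _ (s * (k%:R ^+ 2 * s ^+ k * `|y - x| ^+ 2) +
    k%:R * s ^+ k.+1 * `|y - x| ^+ 2)).
  apply: le_trans (ler_wpM2l (exprn_ge0 2 s0) (ler_normD _ _)) _.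
  rewrite mulrDr lerD//.
    rewrite normrM mulrCA ler_pM// ?mulr_ge0 ?exprn_ge0//.
  rewrite normrM [`|k%:R * _|]normrM !normrX normr_nat.
  have D0 : 0 <= `|y - x| ^+ 2 by rewrite exprn_ge0.
  move: (`|y - x| ^+ 2) D0 => D D0; rewrite mulrA ler_wpM2r//.
  case: k {IH E} => [|k] /=; first by rewrite !mul0r mulr0.
  rewrite mulrCA ler_wpM2l// -[k.+2]add2n exprD ler_wpM2l ?exprn_ge0//.
  by rewrite lerXn2r ?nnegrE.
rewrite mulrA -mulrDl ler_wpM2r ?exprn_ge0//.
have -> : s * (k%:R ^+ 2 * s ^+ k) + k%:R * s ^+ k.+1 =
  (k%:R ^+ 2 + k%:R) * s ^+ k.+1 by rewrite [s ^+ k.+1]exprS; ring.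
rewrite ler_wpM2r ?exprn_ge0// -natr1 sqrrD1 -addrA lerD2l.
by rewrite mulr2n -addrA lerDl addr_ge0.
Qed.

Lemma sqr_le_expr4 (k : nat) : (k ^ 2 <= 4 ^ k)%N.
Proof.
have k2 : (k <= 2 ^ k)%N by rewrite ltnW// ltn_expl.
by have := leq_mul k2 k2; rewrite mulnn -expnMn.
Qed.

(* Dividing the radius by 8 absorbs the factor k^2 of the Taylor remainder of
   [x ^+ k] and leaves a geometric tail. *)
Lemma sqr_expr8_le (r M t : R[i]) (k : nat) :
  0 <= r -> 0 <= M -> t * r ^+ k <= M ->
  k%:R ^+ 2 * (r / 8) ^+ k * t <= M * 2^-1 ^+ k.
Proof.
move=> r0 M0 tM.
have -> : (8 : R[i])^-1 = 4^-1 * 2^-1 by field.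
rewrite !exprMn.
have -> : k%:R ^+ 2 * (r ^+ k * (4^-1 ^+ k * 2^-1 ^+ k)) * t =
   (k%:R ^+ 2 * 4^-1 ^+ k) * (t * r ^+ k) * 2^-1 ^+ k by ring.
rewrite ler_wpM2r ?exprn_ge0 ?invr_ge0//.
apply: le_trans (ler_wpM2l _ tM) _.
  by rewrite mulr_ge0 ?exprn_ge0 ?invr_ge0.
apply: (ler_piMl M0); rewrite exprVn ler_pdivrMr; last exact: exprn_gt0.
by have := sqr_le_expr4 k; rewrite mul1r -(ler_nat R[i]) !natrX.
Qed.

End ConjPowerSeries.

(** * Reading off [dbar] from a first-order expansion *)

Section Dbar.
Context {R : realType}.

Lemma cvg_of_linear_error {V : normedModType R[i]} (G : R -> V) (L : V)
    (d B : R[i]) : 0 < d ->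
  (forall h : R, h != 0 -> `|h%:C%C| < d -> `|G h - L| <= B * `|h%:C%C|) ->
  G h @[h --> (0 : R)^'] --> L.
Proof.
move=> d0 GL; apply/cvgrPdist_le => e e0.
have [x dx] := complex_realP _ (gtr0_real d0).
have x0 : 0 < x by rewrite -ltcR -dx.
(* No sign is assumed for [B]; the product of [B] with the norm of [h] is nonnegative, hence equal
   to its own norm, which lets [|B| + 1] replace [B]. *)
have B0 : 0 < `|B| + 1 by rewrite ltr_wpDl.
have eB0 : 0 < e / (`|B| + 1) by rewrite divr_gt0.
have [y ey] := complex_realP _ (gtr0_real eB0).
have y0 : 0 < y by rewrite -ltcR -ey.
have nR (h : R) : `|h%:C%C| = `|h|%:C%C :> R[i].
  by rewrite normc_def /= expr0n addr0 sqrtr_sqr.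
near=> h.
have hd : `|h%:C%C| < d by rewrite dx nR ltcR; near: h; exact: dnbhs0_lt.
have he : `|h%:C%C| < e / (`|B| + 1).
  by rewrite ey nR ltcR; near: h; exact: dnbhs0_lt.
have h0 : h != 0 by near: h; exact: nbhs_dnbhs_neq.
rewrite distrC.
have G0 := GL h h0 hd.
have /ger0_norm G1 := le_trans (normr_ge0 _) G0.
apply: (le_trans G0); rewrite -G1 normrM normr_id.
rewrite (le_trans _ (_ : (`|B| + 1) * `|h%:C%C| <= _))//.
  by rewrite ler_wpM2r// lerDl.
by rewrite mulrC -ler_pdivlMr// ltW.
Unshelve. all: by end_near. Qed.

(** The derivative along a unit direction u is conj(u) L. The directions 1 and i give L and -i L,
    and (L + i (-i L)) / 2 = L. *)
Lemma dbar_of_quadratic_error {V : normedModType R[i]} (F : cplx R -> V)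
    (a : cplx R) (L : V) (d B : R[i]) : 0 < d ->
  (forall h : R[i], `|h| < d ->
    `|F (a + h) - F a - Num.conj h *: L| <= B * `|h| ^+ 2) ->
  dbar F a = L.
Proof.
move=> d0 FL.
have dir (u : R[i]) : `|u| = 1 ->
    lim ((h%:C%C)^-1 *: (F (a + u * h%:C%C) - F a) @[h --> (0 : R)^'])
      = Num.conj u *: L.
  move=> u1; apply: cvg_lim; first exact: norm_hausdorff.
  apply: (@cvg_of_linear_error _ _ _ d B d0) => h h0 hd.
  have hC0 : h%:C%C != 0 :> R[i] by rewrite (fmorph_eq0 (real_complex R)).
  have -> : Num.conj u *: L = (h%:C%C)^-1 *: (Num.conj (u * h%:C%C) *: L).
    rewrite scalerA rmorphM/= (_ : Num.conj (h%:C%C) = h%:C%C).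
      by rewrite mulrCA mulVf// mulr1.
    exact: conjc_real.
  rewrite -scalerBr normrZ normfV ler_pdivrMl ?normr_gt0//.
  have := FL (u * h%:C%C); rewrite normrM u1 mul1r => /(_ hd)/le_trans; apply.
  by rewrite expr2 mulrCA.
rewrite /dbar.
have -> : partialx F a = L.
  have := dir 1 (normr1 _); rewrite rmorph1 scale1r => <-.
  by rewrite /partialx; under eq_fun do rewrite -[h in a + h]mul1r.
rewrite /partialy dir ?normCi// conjCi scalerA mulrN -expr2 sqrCi opprK scale1r.
by rewrite -mulr2n -[L *+ 2]scaler_nat scalerA mulVf// scale1r.
Qed.

End Dbar.

(** * Termwise differentiation and leading terms *)

Section TermwiseDbar.
Context {R : realType}.

(** The first-order Taylor remainders of the monomials sum to an error quadratic in [h], uniformly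
    dominated by a geometric series, which identifies [dbar F a] with the sum of the differentiated
    series. *)
Lemma conj_pseries_dbar {V : completeNormedModType R[i]} (F : cplx R -> V)
    (c : nat -> V) (a0 : cplx R) :
  conj_pseries F c a0 ->
  conj_pseries (dbar F) (fun l => l.+1%:R *: c l.+1) a0.
Proof.
move=> /conj_pseries_bound[r [M [r0 M0 cM cF]]].
pose s := r / 8; have s0 : 0 < s by rewrite divr_gt0.
have sr : s < r by rewrite ltr_pdivrMr// ltr_pMr// ltr1n.
(* Both [a] and [a + h] stay within [s] of [a0] when [a - a0] and [h] are below [s / 2]. *)
have s20 : 0 < s / 2 by rewrite divr_gt0.
have s2s : s / 2 < s by rewrite ltr_pdivrMr// ltr_pMr// ltr1n.
have cs k : k%:R ^+ 2 * s ^+ k * `|c k| <= M * 2^-1 ^+ k.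
  by apply: sqr_expr8_le => //; exact: ltW.
have s_ge0 := ltW s0; clearbody s.
apply/nbhs_normP; exists (s / 2) => //= a; rewrite /ball_/= distrC => aa0.
set x := Num.conj (a - a0).
have xs : `|x| <= s by rewrite norm_conjC ltW// (lt_trans aa0).
set u := (fun l => _).
have u_dom k : `|u k| <= M / s * 2^-1 ^+ k.
  rewrite /u !normrZ normr_nat normrX [leRHS]mulrAC ler_pdivlMr//.
  apply: (@le_trans _ _ (k.+1%:R ^+ 2 * s ^+ k.+1 * `|c k.+1|)).
    have -> : `|x| ^+ k * (k.+1%:R * `|c k.+1|) * s =
      `|x| ^+ k * (k.+1%:R * s * `|c k.+1|) by ring.
    have -> : k.+1%:R ^+ 2 * s ^+ k.+1 * `|c k.+1| =
      k.+1%:R * s ^+ k * (k.+1%:R * s * `|c k.+1|).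
      by rewrite [s ^+ k.+1]exprS; ring.
    rewrite ler_wpM2r ?mulr_ge0//.
    apply: (@le_trans _ _ (s ^+ k)); first by rewrite lerXn2r ?nnegrE ?s_ge0.
    by rewrite ler_peMl ?exprn_ge0// ler1n.
  rewrite (le_trans (cs _))// ler_wpM2l// exprS ler_piMl ?exprn_ge0 ?invr_ge0//.
  by rewrite invf_le1// ler1n.
have /cvg_ex[L uL] := dominated_series_cvg _ _ _ u_dom.
suff -> : dbar F a = L by [].
apply: (@dbar_of_quadratic_error _ _ F a L (s / 2) (2 * M / s ^+ 2)) => // h hs.
set y := Num.conj (a + h - a0).
have yx : y - x = Num.conj h.
  by rewrite -rmorphB/= (addrAC a) [a - a0 + h]addrC addrK.
have ys : `|a + h - a0| < s.
  rewrite -addrA addrCA addrC (le_lt_trans (ler_normD _ _))//.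
  by rewrite (splitr s) ltrD.
pose E k := (y ^+ k - x ^+ k - k%:R * x ^+ k.-1 * (y - x)) *: c k.
have E_dom k : `|E k| <= `|h| ^+ 2 * M / s ^+ 2 * 2^-1 ^+ k.
  rewrite [leRHS]mulrAC ler_pdivlMr ?exprn_gt0// normrZ.
  apply: (@le_trans _ _ (k%:R ^+ 2 * s ^+ k * `|y - x| ^+ 2 * `|c k|)).
    rewrite mulrAC ler_wpM2r// mulrC pow_taylor1_le//.
    by rewrite norm_conjC ltW.
  rewrite yx norm_conjC mulrAC mulrC -[leRHS]mulrA ler_wpM2l ?exprn_ge0//.
apply: le_trans (dominated_series_le _ E _ _ E_dom _) _; last first.
  by rewrite le_eqVlt; apply/orP; left; apply/eqP; ring.
(* The derivative of the constant term vanishes, so n + 1 terms of [E] involve only n terms of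
   [u]. *)
rewrite -cvg_shiftS/=.
have -> : (fun n => series E n.+1) = (fun n =>
  series (fun l => y ^+ l *: c l) n.+1 - series (fun l => x ^+ l *: c l) n.+1
   - Num.conj h *: series u n).
  apply/funext => n; rewrite /series/=.
  rewrite (eq_bigr (fun k => y ^+ k *: c k - x ^+ k *: c k -
    Num.conj h *: ((k%:R * x ^+ k.-1) *: c k))); last first.
    by move=> k _; rewrite /E yx !scalerBl scalerA (mulrC (Num.conj h)).
  rewrite !sumrB -scaler_sumr; congr (_ - _ *: _).
  rewrite big_nat_recl// mul0r scale0r add0r.
  by apply: eq_bigr => i _; rewrite /u scalerA mulrC.
apply: cvgB; last by apply: cvgZr.
apply: cvgB.
  by rewrite (cvg_shiftS (series _)); apply: cF; exact: lt_trans ys _.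
rewrite (cvg_shiftS (series _)); apply: cF.
exact: lt_trans aa0 (lt_trans s2s _).
Qed.

Lemma conj_pseries_center {V : normedModType R[i]} (F : cplx R -> V)
    (c : nat -> V) (a0 : cplx R) : conj_pseries F c a0 -> F a0 = c 0%N.
Proof.
move=> /nbhs_singleton; rewrite subrr rmorph0 => F0.
suff F1 : series (fun l => (0 : R[i]) ^+ l *: c l) @ \oo --> c 0%N.
  have VT := @norm_hausdorff _ V.
  by rewrite -(cvg_lim VT F0) (cvg_lim VT F1).
(* Since 0^0 = 1, every nonempty partial sum equals [c 0]; the shift skips the empty one. *)
rewrite -cvg_shiftS/=.
rewrite (_ : (fun n => _) = fun=> c 0%N); first exact: cvg_cst.
apply/funext => n; rewrite /series/= big_nat_recl// big1 ?addr0 ?scale1r//.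
by move=> i _; rewrite expr0n scale0r.
Qed.

(** The innermost derivative is peeled off, because [dbar F] is again such a series; hence the
    induction is over all [F] and [c]. *)
Lemma iter_dbar_conj_pseries {V : completeNormedModType R[i]} (F : cplx R -> V)
    (c : nat -> V) (a0 : cplx R) (l : nat) :
  conj_pseries F c a0 -> iter l dbar F a0 = l`!%:R *: c l.
Proof.
elim: l F c => [|l IH] F c Fc.
  by rewrite fact0 scale1r; exact: conj_pseries_center.
rewrite iterSr (IH _ _ (conj_pseries_dbar _ _ _ Fc)) scalerA -natrM.
by rewrite factS mulnC.
Qed.

(** For k > m and |z| < s, |z|^k <= s^(k-m-1) |z|^(m+1); pulling out |z|^(m+1) leaves a geometric
    series, of ratio 1/2 because [s] is [r / 2]. *)
Lemma conj_pseries_leading {V : normedModType R[i]} (F : cplx R -> V)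
    (c : nat -> V) (a0 : cplx R) (m : nat) :
  conj_pseries F c a0 -> (forall l, (l < m)%N -> c l = 0) ->
  exists d B : R[i], 0 < d /\ forall a, `|a - a0| < d ->
    `|F a - Num.conj (a - a0) ^+ m *: c m| <= B * `|a - a0| ^+ m.+1.
Proof.
move=> /conj_pseries_bound[r [M [r0 M0 cM cF]]] cm.
pose s := r / 2; have s0 : 0 < s by rewrite divr_gt0.
have sr : s < r by rewrite ltr_pdivrMr// ltr_pMr// ltr1n.
have cs k : s ^+ k * `|c k| <= M * 2^-1 ^+ k.
  by rewrite /s exprMn mulrAC ler_wpM2r ?exprn_ge0 ?invr_ge0// mulrC.
have s_ge0 := ltW s0; clearbody s.
exists s, (2 * (M / s ^+ m.+1)); split=> // a aa0.
set z := Num.conj (a - a0).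
have zn : `|z| = `|a - a0| by rewrite norm_conjC.
rewrite -zn -mulrA.
(* The series with its m-th term removed has the error as its sum. *)
pose u k := if k == m then 0 else z ^+ k *: c k.
have K0 k : 0 <= M / s ^+ m.+1 * `|z| ^+ m.+1 * 2^-1 ^+ k.
  rewrite mulr_ge0 ?exprn_ge0 ?invr_ge0// mulr_ge0 ?exprn_ge0//.
  by rewrite divr_ge0 ?exprn_ge0.
apply: (dominated_series_le _ u).
  move=> k; rewrite /u; case: ifPn => [_|km].
    by rewrite normr0.
  have [/cm->|mk] := ltnP k m.
    by rewrite scaler0 normr0.
  have {km mk}mk : (m < k)%N by rewrite ltn_neqAle eq_sym km.
  rewrite normrZ normrX (_ : M / _ * _ * _ =
    M * 2^-1 ^+ k * `|z| ^+ m.+1 / s ^+ m.+1); last by ring.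
  rewrite ler_pdivlMr ?exprn_gt0//.
  rewrite -{1}(subnK mk) exprD.
  apply: (@le_trans _ _ (s ^+ k * `|c k| * `|z| ^+ m.+1)).
    have -> : `|z| ^+ (k - m.+1) * `|z| ^+ m.+1 * `|c k| * s ^+ m.+1 =
      `|z| ^+ (k - m.+1) * (s ^+ m.+1 * `|c k| * `|z| ^+ m.+1) by ring.
    have -> : s ^+ k * `|c k| * `|z| ^+ m.+1 =
      s ^+ (k - m.+1) * (s ^+ m.+1 * `|c k| * `|z| ^+ m.+1).
      by rewrite -{1}(subnK mk) exprD; ring.
    rewrite ler_wpM2r ?mulr_ge0 ?exprn_ge0// lerXn2r ?nnegrE//.
    by rewrite zn ltW.
  by rewrite ler_wpM2r ?exprn_ge0.
(* From m + 1 terms on, every partial sum contains the term of index [m]. *)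
rewrite -(cvg_shiftn m.+1)/=.
have -> : (fun n => series u (n + m.+1)%N) = fun n =>
    series (fun l => z ^+ l *: c l) (n + m.+1)%N - z ^+ m *: c m.
  apply/funext => n; rewrite /series/=.
  rewrite (eq_bigr (fun k => z ^+ k *: c k -
    (if k == m then z ^+ k *: c k else 0))); last first.
    by move=> k _; rewrite /u; case: ifP; rewrite ?subrr ?subr0.
  by rewrite sumrB -big_mkcond/= big_nat1_eq addnS ltnS leq_addl.
apply: cvgB; last exact: cvg_cst.
rewrite (cvg_shiftn m.+1 (series _)); apply: cF; exact: lt_trans aa0 _.
Qed.

End TermwiseDbar.

(** * Gram-Schmidt residuals *)

Section GramSchmidt.
Context {R : realType} {E : set (cplx R)} {H : completeNormedModType R[i]}.
Variable K : rkhs E H.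
Implicit Types (s : seq (cplx R)) (vs bs : seq H) (v w : H).

(** The vector that [gs_next] normalises: for orthonormal [bs], the projection of [v] onto their
    orthogonal complement. Unlike [gs_next] it is linear in [v], so it acts on power series
    coefficientwise. *)
Definition gs_residual bs v : H := v - \sum_(b <- bs) ip K v b *: b.

Lemma gs_residual_is_linear bs : linear (gs_residual bs).
Proof.
move=> a u v; rewrite /gs_residual scalerBr scaler_sumr addrACA -opprD -big_split/=.
congr (_ - _); apply: eq_bigr => b _.
by rewrite linearDl linearZl_LR scalerDl scalerA.
Qed.

HB.instance Definition _ bs :=
  GRing.isLinear.Build R[i] H H *:%R (gs_residual bs) (gs_residual_is_linear bs).

Lemma gs_nextE bs v : gs_next K bs v = `|gs_residual bs v|^-1 *: gs_residual bs v.
Proof. by []. Qed.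

Lemma gs_residual_rcons bs e v :
  gs_residual (rcons bs e) v = gs_residual bs v - ip K v e *: e.
Proof. by rewrite /gs_residual -cats1 big_cat/= big_seq1 opprD addrA. Qed.

Lemma ipC v w : ip K v w = Num.conj (ip K w v).
Proof. by rewrite hermC expr0 mul1r. Qed.

(* Weaker than orthonormality in that [0 \in bs] is allowed, so that it holds for
   the Gram-Schmidt sequence of a linearly dependent family too. *)
Definition self_spanning bs := (forall b, b \in bs -> gs_residual bs b = 0) /\
  (forall b v, b \in bs -> ip K (gs_residual bs v) b = 0).

(** The difference between [w] and its residual is a combination of [bs], to which every residual is
    orthogonal. *)
Lemma ip_residual bs v w : self_spanning bs ->
  ip K (gs_residual bs v) w = ip K (gs_residual bs v) (gs_residual bs w).
Proof.
move=> [_ bs0]; rewrite [X in _ = ip K _ X]/gs_residual linearBr raddf_sum/=.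
rewrite big_seq big1 ?subr0// => b bbs.
by rewrite linearZr/= bs0// mulr0.
Qed.

Lemma residual_idem bs v : self_spanning bs ->
  gs_residual bs (gs_residual bs v) = gs_residual bs v.
Proof.
move=> [_ bs0]; rewrite {1}/gs_residual big_seq big1 ?subr0// => b bbs.
by rewrite bs0// scale0r.
Qed.

(** Pythagoras for v = (v - p) + p. This gives the continuity of the residual map. *)
Lemma norm_residual_le bs v : self_spanning bs -> `|gs_residual bs v| <= `|v|.
Proof.
move=> bsP; rewrite -(@ler_pXn2r _ 2)// ?nnegrE// -!(ip_norm K).
set p := gs_residual bs v; rewrite -[in leRHS](subrK p v).
have pv : ip K (v - p) p = 0.
  by rewrite ipC linearBr/= /p (ip_residual _ _ v bsP) subrr rmorph0.
clearbody p; rewrite [leRHS]hnormDd// lerDr -[leRHS]/(ip K (v - p) (v - p)).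
by rewrite ip_norm exprn_ge0.
Qed.

Lemma self_spanning_rcons bs v : self_spanning bs ->
  self_spanning (rcons bs (gs_next K bs v)).
Proof.
move=> bsP; have [bs1 bs2] := bsP.
set e := gs_next K bs v; set w := gs_residual bs v.
have ee : e = `|w|^-1 *: w by [].
have re : gs_residual bs e = e by rewrite ee linearZ/= residual_idem.
have eb b : b \in bs -> ip K e b = 0.
  by move=> bbs; rewrite ee linearZl_LR/= bs2// mulr0.
have be b : b \in bs -> ip K b e = 0.
  by move=> bbs; rewrite ipC eb// rmorph0.
(* Covers both a unit vector [e] and the degenerate [e = 0], which occurs when the residual of [v]
   vanishes. *)
have eee : ip K e e *: e = e.
  have [w0|w0] := eqVneq w 0; first by rewrite ee w0 !scaler0.
  rewrite ip_norm ee normrZ normfV normr_id mulVf ?normr_eq0//.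
  by rewrite expr1n scale1r.
have ue u : ip K (gs_residual bs u) e = ip K u e.
  by rewrite [LHS]ipC [RHS]ipC; have := ip_residual bs e u bsP; rewrite re => ->.
split=> [b|b u]; rewrite mem_rcons inE => /predU1P[->|bbs];
  rewrite gs_residual_rcons.
- by rewrite re eee subrr.
- by rewrite bs1// be// scale0r subr0.
- rewrite linearBl linearZl_LR/= ue.
  have [->|e0] := eqVneq e 0; first by rewrite !linear0r !(mulr0, subr0).
  have : (ip K e e - 1) *: e = 0 by rewrite scalerBl eee scale1r subrr.
  move=> /eqP; rewrite scaler_eq0 (negPf e0) orbF subr_eq0 => /eqP->.
  by rewrite mulr1 subrr.
- by rewrite linearBl linearZl_LR/= bs2// eb// mulr0 subrr.
Qed.

(** [v] is a combination of [bs] and the new vector, and the extended residual kills each of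
    these. *)
Lemma residual_rcons_next bs v : self_spanning bs ->
  gs_residual (rcons bs (gs_next K bs v)) v = 0.
Proof.
move=> bsP; have [cs1 _] := self_spanning_rcons bs v bsP; have [bs1 _] := bsP.
have vE : v = gs_residual bs v + \sum_(b <- bs) ip K v b *: b by rewrite subrK.
have wE : gs_residual bs v = `|gs_residual bs v| *: gs_next K bs v.
  rewrite gs_nextE scalerA; have [->|w0] := eqVneq (gs_residual bs v) 0.
    by rewrite scaler0.
  by rewrite mulfV ?normr_eq0// scale1r.
rewrite [X in gs_residual _ X]vE wE linearD linearZ/= cs1 ?mem_rcons ?mem_head//.
rewrite scaler0 add0r linear_sum big_seq big1// => b bbs.
by rewrite linearZ/= cs1 ?scaler0// mem_rcons inE bbs orbT.
Qed.

Lemma gram_schmidt_self_spanning vs :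
  self_spanning (gram_schmidt K vs) /\
  forall v, v \in vs -> gs_residual (gram_schmidt K vs) v = 0.
Proof.
elim/last_ind: vs => [|vs v [IH1 IH2]]; first by [].
rewrite /gram_schmidt foldl_rcons -/(gram_schmidt K vs); split.
  exact: self_spanning_rcons.
move=> u; rewrite mem_rcons inE => /predU1P[->|/IH2 u0].
  exact: residual_rcons_next.
rewrite gs_residual_rcons u0 sub0r.
(* An earlier [u] has zero residual, hence is orthogonal to every residual and to the new vector. *)
have -> : ip K u (gs_next K (gram_schmidt K vs) v) = 0.
  rewrite gs_nextE linearZr/= ipC ip_residual//.
  by rewrite u0 linear0r rmorph0 mulr0.
by rewrite scale0r oppr0.
Qed.

(** Coefficients are indexed as in [lin_indep], so that membership turns directly into a vanishing
    combination. *)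
Definition in_span vs v :=
  exists c : nat -> R[i], v = \sum_(0 <= i < size vs) c i *: nth 0 vs i.

Lemma in_spanD vs v w : in_span vs v -> in_span vs w -> in_span vs (v + w).
Proof.
move=> [c ->] [d ->]; exists (fun i => c i + d i).
by rewrite -big_split; apply: eq_bigr => i _; rewrite scalerDl.
Qed.

Lemma in_spanZ vs a v : in_span vs v -> in_span vs (a *: v).
Proof.
move=> [c ->]; exists (fun i => a * c i).
by rewrite scaler_sumr; apply: eq_bigr => i _; rewrite scalerA.
Qed.

Lemma in_span0 vs : in_span vs 0.
Proof. by exists (fun=> 0); rewrite big1// => i _; rewrite scale0r. Qed.

Lemma in_span_sum vs (I : eqType) (r : seq I) (F : I -> H) :
  (forall i, i \in r -> in_span vs (F i)) -> in_span vs (\sum_(i <- r) F i).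
Proof.
move=> rF; rewrite big_seq; elim/big_ind : _ => //.
- exact: in_span0.
- exact: in_spanD.
Qed.

Lemma in_span_rcons vs w v : in_span vs v -> in_span (rcons vs w) v.
Proof.
move=> [c ->]; exists (fun i => if (i < size vs)%N then c i else 0).
rewrite size_rcons big_nat_recr//= ltnn scale0r addr0 big_nat [RHS]big_nat.
by apply: eq_bigr => i; rewrite nth_rcons => /= ->.
Qed.

Lemma in_span_last vs v : in_span (rcons vs v) v.
Proof.
exists (fun i => (i == size vs)%:R).
rewrite size_rcons big_nat_recr//= eqxx scale1r nth_rcons ltnn eqxx.
rewrite big_nat big1 ?add0r//.
by move=> i ivs; rewrite ltn_eqF// scale0r.
Qed.

Lemma gram_schmidt_in_span vs b : b \in gram_schmidt K vs -> in_span vs b.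
Proof.
elim/last_ind: vs b => [|vs v IH] b; first by [].
rewrite /gram_schmidt foldl_rcons -/(gram_schmidt K vs) mem_rcons inE.
move=> /predU1P[->|/IH]; last exact: in_span_rcons.
apply: in_spanZ; rewrite -scaleN1r; apply: in_spanD; first exact: in_span_last.
apply/in_spanZ/in_span_sum => u /IH uvs; exact/in_spanZ/in_span_rcons.
Qed.

Lemma residual_neq0 vs v : lin_indep (rcons vs v) ->
  gs_residual (gram_schmidt K vs) v != 0.
Proof.
move=> free; apply/eqP => /eqP; rewrite subr_eq0 => /eqP vE.
have [c cE] : in_span vs v.
  rewrite vE; apply: in_span_sum => b bvs.
  exact/in_spanZ/gram_schmidt_in_span.
(* A zero residual puts [v] in the span of [vs]; moving [v] across gives a relation whose last
   coefficient is -1. *)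
have := free (fun i => if (i < size vs)%N then c i else -1).
rewrite size_rcons big_nat_recr//= ltnn nth_rcons ltnn eqxx scaleN1r.
rewrite [X in _ - X]cE big_nat.
rewrite (eq_bigr (fun i => c i *: nth 0 vs i)); last first.
  by move=> i /= ivs; rewrite nth_rcons ivs.
rewrite -big_nat subrr => /(_ erefl (size vs) (leqnn _)).
by rewrite ltnn => /eqP; rewrite oppr_eq0 oner_eq0.
Qed.

(** The occurrence number l + 1 of [a] in [s] contributes the derivative of order [l]. *)
Lemma iter_dbar_in_ktildes s a l : (l < count_mem a s)%N ->
  iter l dbar (Defs.kernel K) a \in ktildes K s.
Proof.
elim/last_ind: s => [//|s x IH].
rewrite ktildes_rcons -cats1 count_cat/= addn0 mem_rcons inE.
have [ls _|sl] := ltnP l (count_mem a s); first by rewrite IH ?orbT.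
case: eqP => [->|_]; last by rewrite addn0 ltnNge sl.
rewrite addn1 ltnS => ls.
have -> : l = count_mem a s by apply/eqP; rewrite eqn_leq ls.
by rewrite /ktilde /mult -cats1 count_cat/= eqxx addn0 addn1 eqxx.
Qed.

End GramSchmidt.

(** * Convergence of the normalised residuals *)

Lemma cvg_normalize {K : numFieldType} {V : normedModType K} {T : Type}
    (F : set_system T) {FF : Filter F} (G : T -> V) (l : V) :
  l != 0 -> G @ F --> l -> `|G x|^-1 *: G x @[x --> F] --> `|l|^-1 *: l.
Proof.
move=> l0 Gl; apply: cvgZ => //; apply: cvgV; first by rewrite normr_eq0.
exact: cvg_norm.
Qed.

Lemma cvg_normalized_conj_pseries {R : realType} {V : normedModType R[i]}
    (F : cplx R -> V) (c : nat -> V) (a0 : cplx R) (m : nat)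
    (b : nat -> cplx R) :
  conj_pseries F c a0 -> (forall l, (l < m)%N -> c l = 0) -> c m != 0 ->
  b @ \oo --> a0 -> (forall j, (0 < m)%N -> b j != a0) ->
  ((b j - a0) / `|b j - a0|) ^+ m *: (`|F (b j)|^-1 *: F (b j))
    @[j --> \oo] --> `|c m|^-1 *: c m.
Proof.
move=> Fc cm0 cm b_a0 ba0.
have [d [B [d0 FB]]] := conj_pseries_leading _ _ _ _ Fc cm0.
pose z j : R[i] := Num.conj (b j - a0).
have zn j : `|z j| = `|b j - a0| by rewrite norm_conjC.
(* For [m = 0] the point [b j] may equal [a0]; the power is then 0^0 = 1. *)
have zm j : z j ^+ m != 0.
  case: m ba0 {cm0 cm FB} => [|m] /(_ j) ba0; first by rewrite expr0 oner_neq0.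
  by rewrite expf_neq0// conjC_eq0 subr_eq0 ba0.
pose G j := (z j ^+ m)^-1 *: F (b j).
have FG j : F (b j) = z j ^+ m *: G j by rewrite scalerA mulfV// scale1r.
have Gcm : G @ \oo --> c m.
  apply/cvgrPdist_le => e e0.
  have B0 : 0 < `|B| + 1 by rewrite ltr_wpDl.
  have eB0 : 0 < e / (`|B| + 1) by rewrite divr_gt0.
  move/cvgrPdistC_lt : b_a0 => b_a0.
  near=> j.
  have jd : `|b j - a0| < d by near: j; exact: b_a0.
  have je : `|b j - a0| < e / (`|B| + 1) by near: j; exact: b_a0.
  have := FB _ jd; rewrite -/(z j) FG -scalerBr normrZ normrX zn exprSr mulrA.
  rewrite mulrAC mulrC ler_pM2r; last by rewrite -zn -normrX normr_gt0.
  rewrite distrC => G0; have /ger0_norm G1 := le_trans (normr_ge0 _) G0.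
  apply: (le_trans G0); rewrite -G1 normrM normr_id.
  apply: (@le_trans _ _ ((`|B| + 1) * `|b j - a0|)).
    by rewrite ler_wpM2r// lerDl.
  by rewrite mulrC -ler_pdivlMr// ltW.
(* Normalising [F (b j)] instead of [G j] adds the phase (z/|z|)^m, which the prefactor cancels
   because (b_j - a0) z_j = |z_j|^2. *)
have -> : (fun j => ((b j - a0) / `|b j - a0|) ^+ m *:
    (`|F (b j)|^-1 *: F (b j))) = fun j => `|G j|^-1 *: G j.
  apply/funext => j; rewrite FG normrZ normrX; move: (G j) => g.
  rewrite !scalerA; congr (_ *: _).
  have zz : (b j - a0) * z j = `|z j| ^+ 2 by rewrite zn normCK.
  have zj0 : `|z j| ^+ m != 0 by rewrite -normrX normr_eq0.
  rewrite -zn expr_div_n invfM.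
  have -> : (b j - a0) ^+ m / `|z j| ^+ m * (`|z j| ^- m / `|g|) * z j ^+ m =
    ((b j - a0) * z j) ^+ m / (`|z j| ^+ m * `|z j| ^+ m) / `|g|.
    by rewrite exprMn invfM; ring.
  by rewrite zz exprAC expr2 mulfV ?mul1r// mulf_neq0.
exact: cvg_normalize.
Unshelve. all: by end_near. Qed.

(** The residual is linear and norm-nonincreasing, so it passes through the limit of partial
    sums. *)
Lemma conj_pseries_residual {R : realType} {E : set (cplx R)}
    {H : completeNormedModType R[i]} (K : rkhs E H) (bs : seq H)
    (F : cplx R -> H) (c : nat -> H) (a0 : cplx R) : self_spanning K bs ->
  conj_pseries F c a0 ->
  conj_pseries (gs_residual K bs \o F) (gs_residual K bs \o c) a0.
Proof.
move=> bsP; apply: filterS => a /cvgrPdist_le Fa; apply/cvgrPdist_le => e e0.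
near=> n.
rewrite /series/= (eq_bigr (fun l =>
  gs_residual K bs (Num.conj (a - a0) ^+ l *: c l))).
  rewrite -linear_sum -linearB/= (le_trans (norm_residual_le _ _ _ bsP))//.
  by near: n; exact: Fa.
by move=> l _; rewrite linearZ.
Unshelve. all: by end_near. Qed.

(** When [an] occurs in [s], B_n^(b_j) carries the phase (conj z_j / |z_j|)^m, which need not
    converge as b_j turns around [an]; the prefactor compensates it. With m = 0 it is 1. *)
Theorem lemma3p4 (R : realType) (E : set (cplx R))
    (H : completeNormedModType R[i]) (K : rkhs E H)
    (Eopen : open E) (Econn : connected E)
    (bvc : boundary_vanishing K)
    (s : seq (cplx R)) (sE : forall a, a \in s -> E a)
    (f : H) (b : nat -> cplx R) (an : cplx R)
    (bE : forall j, E (b j)) (bs : forall j, b j \notin s)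
    (anE : E an) (b_an : b @ \oo --> an)
    (s_indep : lin_indep (ktildes K (rcons s an)))
    (M : cplx R)
    (M_attained : [set `|ip K f (Bnext K s a)| | a in E] M)
    (M_ub : forall a, E a -> `|ip K f (Bnext K s a)| <= M)
    (b_max : (`|ip K f (Bnext K s (b j))| : cplx R) @[j --> \oo] --> M) :
  (an \notin s -> Bnext K s (b j) @[j --> \oo] --> Bnext K s an) /\
  ((b j - an) / `|b j - an|) ^+ count_mem an s *: Bnext K s (b j)
    @[j --> \oo] --> Bnext K s an.
Proof.
set m := count_mem an s.
suff main : ((b j - an) / `|b j - an|) ^+ m *: Bnext K s (b j)
    @[j --> \oo] --> Bnext K s an.
  split=> // /count_memPn m0; move: main; rewrite /m m0.
  by under eq_fun do rewrite expr0 scale1r.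
have [c kc] := kernel_analytic K anE.
have dkc l : iter l dbar (Defs.kernel K) an = l`!%:R *: c l.
  exact: iter_dbar_conj_pseries.
have fact_neq0 l : l`!%:R != 0 :> R[i] by rewrite pnatr_eq0 -lt0n fact_gt0.
pose P := gs_residual K (gram_schmidt K (ktildes K s)).
have [Pss P0] := gram_schmidt_self_spanning K (ktildes K s).
have ktE : ktilde K s an = m`!%:R *: c m.
  by rewrite /ktilde /mult -cats1 count_cat/= eqxx addn0 addn1.
(* Up to l!, [c l] is the derivative of order l < m, which is one of the vectors killed by [P]. *)
have Pc0 l : (l < m)%N -> P (c l) = 0.
  move=> /iter_dbar_in_ktildes/P0; rewrite dkc linearZ/= => /eqP.
  by rewrite scaler_eq0 (negPf (fact_neq0 l)) => /eqP.
have Pcm : P (c m) != 0.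
  have := residual_neq0 K (ktildes K s) (ktilde K s an).
  rewrite -ktildes_rcons => /(_ s_indep).
  by rewrite ktE linearZ/= scaler_eq0 (negPf (fact_neq0 m)).
have ban j : (0 < m)%N -> b j != an.
  by rewrite -has_count has_pred1 => ans; apply: contraNneq (bs j) => ->.
(* The positive factor m! disappears under normalisation. *)
have -> : Bnext K s an = `|P (c m)|^-1 *: P (c m).
  rewrite /Bnext gs_nextE ktE linearZ/= normrZ scalerA invfM.
  by rewrite normr_nat mulrAC mulVf// mul1r.
under eq_fun => j do rewrite /Bnext ktilde_notin// gs_nextE.
have Pkc := conj_pseries_residual _ _ _ _ _ Pss kc.
exact: cvg_normalized_conj_pseries Pkc Pc0 Pcm b_an ban.
Qed.
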